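(* Let $q\ge2$ be an integer and let $R(z,u)$ be the unique formal power series (in $z$, with coefficients polynomials in $u$) such that $$R=z+u\sum_{i\ge1}\frac{((2q-1)i)!}{i!\,((q-1)i)!\,((q-1)i+1)!}R^{(q-1)i+1}.$$ Then for every $n\in\{1,\dots,q\}$, the series $(R^n-z^n)/u$ is $(u+1)$-positive.
   Context: A formal power series $A$ in variables $z_1,\dots,z_m$ with coefficients in $\mathbb R[u]$ is called $(u+1)$-positive if, after substituting $u=\mu-1$, the series $A(\mu-1,z_1,\dots,z_m)$ has nonnegative coefficients as a series in $\mu,z_1,\dots,z_m$ (i.e. its coefficients are nonnegative in the basis given by monomials in $1+u,z_1,\dots,z_m$). *)

(* Defs.v *)
From HB Require Import structures.
From mathcomp Require Import all_boot all_order all_algebra.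
Set Implicit Arguments. Unset Strict Implicit. Unset Printing Implicit Defensive.
Import Order.TTheory GRing.Theory Num.Theory.
Local Open Scope ring_scope.

(* Formal power series in z with coefficients in K[u]:  a series is the
   sequence of its z-coefficients, each a polynomial in u (= 'X). *)
Definition fps (K : realFieldType) := nat -> {poly K}.

Definition fps_one (K : realFieldType) : fps K := fun k => (k == 0%N)%:R.

Definition fps_zpow (K : realFieldType) (n : nat) : fps K :=
  fun k => (k == n)%:R.

Definition fps_mul (K : realFieldType) (f g : fps K) : fps K :=
  fun k => \sum_(i < k.+1) f i * g (k - i)%N.

Definition fps_exp (K : realFieldType) (f : fps K) (m : nat) : fps K :=
  iter m (fps_mul f) (fps_one K).

Definition rcoef (K : realFieldType) (q i : nat) : K :=
  ((((2 * q - 1) * i)%N `!)%:R) /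
  ((i `!)%:R * ((((q - 1) * i)%N `!)%:R) * (((((q - 1) * i)%N.+1) `!)%:R)).

(* R satisfies  R = z + u * sum_{i>=1} c_i R^{(q-1)i+1}  as formal power
   series.  Since R has zero constant term, R^{(q-1)i+1} has z-order
   >= (q-1)i+1 > i, so the coefficient of z^k of the infinite sum only
   involves the (finitely many) terms 1 <= i <= k. *)
Definition is_R_series (K : realFieldType) (q : nat) (R : fps K) : Prop :=
  R 0%N = 0 /\
  forall k : nat,
    R k = (k == 1%N)%:R +
          'X * \sum_(1 <= i < k.+1)
                 (rcoef K q i)%:P * fps_exp R ((q - 1) * i)%N.+1 k.

Definition uplus1_positive (K : realFieldType) (A : fps K) : Prop :=
  forall k j : nat, 0 <= ((A k) \Po ('X - 1))`_j.

(* Main.v *)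
(* Put p = q - 1 and write R = z * rho(w) with w = z^p.  Let
   G = a + w * G^(2p+1) with a = rho * s + 1/s: G counts (2p+1)-ary trees whose
   leaves have charge +1 (weight rho) or -1, and G_c denotes the coefficient of
   s^c, the trees of total charge c.  The numbers in the theorem are the
   Fuss-Catalan numbers times a binomial, so that G_1 = rho + phi with
   rho = 1 + u * phi; hence G_1 = 1 + (u + 1) * phi, and rho * G_(-1) = G_1 by
   the symmetry s <-> 1/(rho * s) of a.

   Since (R^n - z^n)/u = z^n * phi * (1 + rho + ... + rho^(n-1)), it is enough
   that rho^k * phi be (u+1)-positive for k <= p, although rho itself is not.
   Expand phi, the charge 1 part of w * G^(2p+1), over the charges of the 2p+1
   subtrees: these are odd and add up to 1, so the negative ones add up to at
   most -p.  The factors rho can therefore be distributed over subtrees of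
   charge -a, at most a to each, and rho^r * G_(-a) with r <= a is
   (u+1)-positive by the same argument, by induction on the order in w. *)
Require Import Defs.
From HB Require Import structures.
From mathcomp Require Import all_boot all_order all_algebra.
From mathcomp Require Import zify ring.
Import Order.TTheory GRing.Theory Num.Theory.
Local Open Scope ring_scope.

(** * Polynomials positive in 1 + u *)

Definition upos {K : realFieldType} (a : {poly K}) : Prop :=
  forall j, 0 <= (a \Po ('X - 1))`_j.

Lemma uposD {K : realFieldType} (a c : {poly K}) :
  upos a -> upos c -> upos (a + c).
Proof. by move=> a0 c0 j; rewrite comp_polyD coefD addr_ge0. Qed.

Lemma uposM {K : realFieldType} (a c : {poly K}) :
  upos a -> upos c -> upos (a * c).
Proof.
by move=> a0 c0 j; rewrite comp_polyM coefM sumr_ge0 // => i _; rewrite mulr_ge0.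
Qed.

Lemma upos_nat (K : realFieldType) (n : nat) : upos (n%:R : {poly K}).
Proof. by move=> j; rewrite rmorph_nat -polyC_natr coefC; case: ifP. Qed.

Lemma upos0 (K : realFieldType) : upos (0 : {poly K}).
Proof. by rewrite -(mulr0n 1); apply: upos_nat. Qed.

Lemma upos_sum {K : realFieldType} {I : Type} {r : seq I} {P : pred I}
    {F : I -> {poly K}} :
  (forall i, P i -> upos (F i)) -> upos (\sum_(i <- r | P i) F i).
Proof.
move=> h; elim/big_ind: _ => //; [exact: upos0 | exact: uposD].
Qed.

Lemma upos_uplus1 (K : realFieldType) : upos ('X + 1 : {poly K}).
Proof.
move=> j; rewrite comp_polyD comp_polyX (rmorph1 (comp_poly _)) subrK coefX.
by case: (j == 1)%N.
Qed.

(** * Raney (Fuss-Catalan) numbers *)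

(* [raney b n m] is the coefficient of w^n in B^m where B = 1 + w * B^b. *)
Fixpoint raney (b n m : nat) : nat :=
  if n is n'.+1 then (\sum_(l < m) raney b n' (l + b))%N else 1%N.

Lemma raney0 (b m : nat) : raney b 0 m = 1%N. Proof. by []. Qed.

Lemma raneySS (b n m : nat) :
  raney b n.+1 m.+1 = (raney b n.+1 m + raney b n (m + b))%N.
Proof. by rewrite /= big_ord_recr. Qed.

(** Both sides obey the recurrence [raneySS] in m1, so induction on n and then on m1 suffices. *)
Lemma raneyD (b n m1 m2 : nat) :
  (\sum_(i < n.+1) raney b i m1 * raney b (n - i) m2)%N = raney b n (m1 + m2).
Proof.
elim: n m1 m2 => [|n IHn] m1 m2; first by rewrite big_ord_recl big_ord0.
elim: m1 => [|m1 IHm].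
  rewrite big_ord_recl big1 ?addn0; last by move=> i _; rewrite /= big_ord0.
  by rewrite mul1n subn0.
rewrite addSn raneySS -IHm [in RHS]addnAC -IHn.
rewrite [LHS]big_ord_recl [in RHS]big_ord_recl !raney0 -addnA; congr addn.
rewrite -big_split; apply: eq_bigr => i _.
by rewrite lift0 subSS raneySS mulnDl.
Qed.

(** Raney's formula (m+1)/(bn+m+1) * binomial(bn+m+1, n) with b = 2p+1, cleared of denominators. *)
Lemma raney_fact (p n m : nat) :
  (raney (2 * p).+1 n m.+1 * (n`! * (2 * p * n + m.+1)`!)
   = m.+1 * ((2 * p).+1 * n + m)`!)%N.
Proof.
elim: n m => [|n IHn] m; first by rewrite raney0 !muln0 !add0n fact0 !mul1n factS.
elim: m => [|m IHm].
  rewrite raneySS add0n [raney _ _ 0]big_ord0 add0n.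
  have := IHn (2 * p)%N; rewrite factS.
  have -> : (2 * p * n.+1 + 1 = 2 * p * n + (2 * p).+1)%N by lia.
  have -> : ((2 * p).+1 * n.+1 + 0 = ((2 * p).+1 * n + 2 * p).+1)%N by lia.
  by rewrite [((_).+1)`!]factS => h; nia.
rewrite raneySS mulnDl.
have -> : (2 * p * n.+1 + m.+2 = (2 * p * n.+1 + m.+1).+1)%N by lia.
have -> : ((2 * p).+1 * n.+1 + m.+1 = ((2 * p).+1 * n.+1 + m).+1)%N by lia.
have := IHn (m + (2 * p).+1)%N.
have -> : (2 * p * n + (m + (2 * p).+1).+1 = (2 * p * n.+1 + m.+1).+1)%N by lia.
have -> : ((2 * p).+1 * n + (m + (2 * p).+1) = (2 * p).+1 * n.+1 + m)%N by lia.
move: IHm; rewrite (factS n) (factS (2 * p * n.+1 + m.+1)).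
rewrite (factS ((2 * p).+1 * n.+1 + m)).
set a := raney _ _ _; set c := raney _ _ _; set f := n`!.
set g := (2 * p * _ + _)`!%N; set h := (_ + m)`! => e1 e2.
transitivity ((2 * p * n.+1 + m.+1).+1 * (a * (n.+1 * f * g))
  + n.+1 * (c * (f * ((2 * p * n.+1 + m.+1).+1 * g))))%N; first by ring.
by rewrite e1 e2; ring.
Qed.

(** * Homogenized polynomials *)

(* The homogenization y^d * Q(x / y), for Q of degree at most d. *)
Definition homog {B : comNzRingType} (x y : B) (d : nat) (Q : {poly B}) : B :=
  \sum_(n < d.+1) Q`_n * x ^+ n * y ^+ (d - n).

Lemma homogM (B : comNzRingType) (x y : B) (d e : nat) (P Q : {poly B}) :
  (size P <= d.+1)%N -> (size Q <= e.+1)%N ->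
  homog x y d P * homog x y e Q = homog x y (d + e) (P * Q).
Proof.
move=> sP sQ.
have expand m (F : {poly B}) : (size F <= m)%N ->
    F = \sum_(i < m) F`_i *: 'X^i.
  move=> sF; rewrite -poly_def; apply/polyP => i; rewrite coef_poly.
  by case: ltnP => // h; rewrite nth_default // (leq_trans sF).
have -> : P * Q
    = \sum_(i < d.+1) \sum_(j < e.+1) (P`_i * Q`_j) *: 'X^(i + j).
  rewrite [in LHS](expand _ _ sP) [in LHS](expand _ _ sQ) mulr_suml.
  apply: eq_bigr => i _; rewrite mulr_sumr; apply: eq_bigr => j _.
  by rewrite -scalerAl -scalerAr scalerA exprD.
have homog_sum m (I : finType) (F : I -> {poly B}) :
    homog x y m (\sum_i F i) = \sum_i homog x y m (F i).
  rewrite /homog exchange_big; apply: eq_bigr => n _.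
  by rewrite coef_sum !mulr_suml.
rewrite homog_sum {1 2}/homog mulr_suml; apply: eq_bigr => i _.
rewrite homog_sum mulr_sumr; apply: eq_bigr => j _.
have lij : (i + j < (d + e).+1)%N by have := ltn_ord i; have := ltn_ord j; lia.
rewrite /homog (bigD1 (Ordinal lij)) //= big1 ?addr0; last first.
  move=> k ne; rewrite coefZ coefXn; case: eqP => [h|]; last by rewrite mulr0 !mul0r.
  by case/eqP: ne; apply: val_inj.
rewrite coefZ coefXn eqxx mulr1.
have -> : (d + e - (i + j) = (d - i) + (e - j))%N.
  by have := ltn_ord i; have := ltn_ord j; lia.
by rewrite !exprD; ring.
Qed.

Lemma homogX (B : comNzRingType) (x y : B) (d m : nat) (Q : {poly B}) :
  (size Q <= d.+1)%N ->
  (size (Q ^+ m) <= (m * d).+1)%N /\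
  homog x y d Q ^+ m = homog x y (m * d) (Q ^+ m).
Proof.
move=> sQ; elim: m => [|m [IHs IHm]].
  rewrite !expr0 size_poly1 /homog big_ord_recl big_ord0 coef1 /=.
  by rewrite !mulr1 addr0.
rewrite !exprS IHm homogM //; split=> //.
apply: leq_trans (size_mul_leq _ _) _; lia.
Qed.

Lemma homog_tail (B : comNzRingType) (x y : B) (d N : nat) (Q : {poly B}) :
  (forall n, (n <= N)%N -> Q`_n = 0) ->
  exists h, homog x y d Q = x ^+ N.+1 * h.
Proof.
move=> Q0; exists (\sum_(n < d.+1) Q`_n * x ^+ (n - N.+1) * y ^+ (d - n)).
rewrite mulr_sumr; apply: eq_bigr => n _; have [le|lt] := leqP n N.
  by rewrite Q0 // !mul0r mulr0.
have -> : x ^+ n = x ^+ N.+1 * x ^+ (n - N.+1) by rewrite -exprD subnKC.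
by ring.
Qed.

Definition raney_poly (B : comNzRingType) (b N : nat) : {poly B} :=
  \poly_(n < N.+1) (raney b n 1)%:R.

Lemma coef_raney_polyX (B : comNzRingType) (b N m n : nat) :
  (n <= N)%N -> (raney_poly B b N ^+ m)`_n = (raney b n m)%:R.
Proof.
elim: m n => [|m IHm] n le.
  by rewrite expr0 coef1; case: n le => //= n _; rewrite big_ord0.
rewrite exprS coefM -(add1n m) -raneyD natr_sum; apply: eq_bigr => i _.
rewrite natrM IHm; last exact: leq_trans (leq_subr _ _) le.
by rewrite coef_poly ltnS (leq_trans _ le) // -ltnS.
Qed.

(** * The truncated tree series, graded by charge *)

(* The truncation of G at order N in w, as a polynomial in y = s^2 after
   multiplication by s^(2pN+1): charge c sits at y^k with c = 2k - (2pN+1). *)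
Definition skel {S : comNzRingType} (p N : nat) (w rho : S) : {poly S} :=
  let alpha := 1 + rho%:P * 'X in
  alpha * homog (w%:P * alpha ^+ (2 * p)) 'X^p N (raney_poly _ (2 * p).+1 N).

(** The series G = a * B(w * a^(2p)) solves G = a + w * G^(2p+1), because B(x) = 1 + x *
    B(x)^(2p+1). This is that equation times s^((2p+1)(2pN+1)); h carries the truncation error. *)
Lemma skel_eq (S : comNzRingType) (p N : nat) (w rho : S) :
  exists h : {poly S},
    w%:P * skel p N w rho ^+ (2 * p).+1
    = (skel p N w rho - 'X^(p * N) * (1 + rho%:P * 'X)) * 'X^(p * (2 * p * N).+1)
      + (w ^+ N.+1)%:P * h.
Proof.
rewrite /skel; cbv zeta; set b := (2 * p).+1.
set alpha := 1 + _; set x := w%:P * alpha ^+ (2 * p); set B := raney_poly _ _ _.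
have sB : (size B <= N.+1)%N by exact: size_poly.
have [sBb eB] := @homogX _ x 'X^p N b B sB.
have hX : homog x 'X^p 1 'X = x.
  by rewrite /homog !big_ord_recl big_ord0 !coefX
    lift0 subnn /= !mul0r add0r addr0 mul1r mulr1.
have hX0 d : homog x 'X^p d 1 = 'X^p ^+ d.
  rewrite /homog big_ord_recl big1 => [|i _]; last by rewrite coef1 !mul0r.
  by rewrite coef1 subn0 /= !mul1r addr0.
set d := (2 * p * N).+1.
have e1 : x * homog x 'X^p N B ^+ b = homog x 'X^p (d + N) ('X * B ^+ b).
  rewrite eB -{1}hX homogM ?size_polyX //; congr homog.
  by rewrite /d /b; lia.
have e2 : 'X^p ^+ d * homog x 'X^p N B = homog x 'X^p (d + N) B.
  by rewrite -hX0 homogM ?mul1r // size_poly1.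
(* The truncated B satisfies its equation up to degree N, so the defect homogenizes to a multiple of
   x^(N+1), hence of w^(N+1). *)
have [n le|h eh] := @homog_tail _ x 'X^p (d + N) N ('X * B ^+ b - B + 1).
  rewrite coefD coefB coefXM coef1 coef_poly ltnS le.
  case: n le => [|n] le; first by rewrite raney0 sub0r addNr.
  rewrite coef_raney_polyX ?(ltnW le) //=.
  by rewrite big_ord_recl big_ord0 add0n addn0 subrr addr0.
have e3 : homog x 'X^p (d + N) ('X * B ^+ b - B + 1)
   = homog x 'X^p (d + N) ('X * B ^+ b) - homog x 'X^p (d + N) B
     + homog x 'X^p (d + N) 1.
  rewrite /homog -sumrB -big_split; apply: eq_bigr => i _.
  by rewrite coefD coefB !mulrDl !mulNr.
exists (alpha * (alpha ^+ (2 * p)) ^+ N.+1 * h).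
have -> : w%:P * (alpha * homog x 'X^p N B) ^+ b
    = alpha * (x * homog x 'X^p N B ^+ b).
  by rewrite exprMn /b exprS /x; ring.
rewrite e1.
have -> : homog x 'X^p (d + N) ('X * B ^+ b)
   = homog x 'X^p (d + N) B - homog x 'X^p (d + N) 1 + x ^+ N.+1 * h.
  by rewrite -eh e3; ring.
have -> : x ^+ N.+1 = (w ^+ N.+1)%:P * (alpha ^+ (2 * p)) ^+ N.+1.
  by rewrite /x exprMn polyC_exp.
rewrite -e2 hX0 exprD !exprM; ring.
Qed.

Lemma coef_1addCX_exp (S : comNzRingType) (rho : S) (m j : nat) :
  ((1 + rho%:P * 'X) ^+ m)`_j = rho ^+ j *+ 'C(m, j).
Proof.
rewrite exprDn coef_sum.
under eq_bigr => i _ do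
  rewrite expr1n mul1r exprMn -polyC_exp coefMn coefCM coefXn.
have [lt|le] := ltnP j m.+1; last first.
  rewrite big1 ?bin_small ?mulr0n // => i _.
  by case: eqP => [e|]; [move: (ltn_ord i); rewrite -e ltnNge le | rewrite mulr0 mul0rn].
rewrite (bigD1 (Ordinal lt)) //= eqxx mulr1 big1 ?addr0 // => i ne.
case: eqP => [e|_]; last by rewrite mulr0 mul0rn.
by case/eqP: ne; apply: val_inj.
Qed.

(** Index pN + e is charge 2e - 1: a tree with n inner nodes has 2pn + 1 leaves, pn + e of them
    positive. [raney] counts the shapes, the binomial the choices of positive leaves. *)
Lemma coef_skel (S : comNzRingType) (p N e : nat) (w rho : S) :
  (skel p N w rho)`_(p * N + e)
  = \sum_(n < N.+1)
      (raney (2 * p).+1 n 1 * 'C((2 * p * n).+1, p * n + e))%:R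
      * w ^+ n * rho ^+ (p * n + e).
Proof.
rewrite /skel /homog mulr_sumr coef_sum; apply: eq_bigr => n _.
rewrite coef_poly ltn_ord.
set alpha := 1 + _.
have -> : alpha * ((raney (2 * p).+1 n 1)%:R * (w%:P * alpha ^+ (2 * p)) ^+ n
                   * 'X^p ^+ (N - n))
  = ((raney (2 * p).+1 n 1)%:R * w ^+ n)%:P * (alpha ^+ (2 * p * n).+1
     * 'X^(p * (N - n))).
  by rewrite polyCM polyC_natr polyC_exp exprMn -!exprM exprS; ring.
rewrite coefCM coefMXn.
have le : (p * (N - n) + p * n = p * N)%N by rewrite -mulnDr subnK // -ltnS.
case: ltnP => [|_]; first by lia.
have -> : (p * N + e - p * (N - n) = p * n + e)%N by lia.
by rewrite coef_1addCX_exp natrM -mulr_natr; ring.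
Qed.

(* rho * G_(-1) = G_1 *)
Lemma coef_skel_sym (S : comNzRingType) (p N : nat) (w rho : S) :
  rho * (skel p N w rho)`_(p * N) = (skel p N w rho)`_(p * N).+1.
Proof.
rewrite -[in LHS](addn0 (p * N)%N) -[in RHS]addn1 !coef_skel mulr_sumr.
apply: eq_bigr => n _; rewrite addn0 addn1.
have -> : 'C((2 * p * n).+1, p * n) = 'C((2 * p * n).+1, (p * n).+1).
  by rewrite -bin_sub; [congr binomial; lia | lia].
by rewrite exprS; ring.
Qed.

(** * Distributing the factors rho over the charges *)

(* If m odd charges add up to c, minus the sum of the negative ones is at least
   max(0, (m-c)/2, -c).  The bound on r is this maximum at the index k of
   charge c = 2k - m(2pN+1), by truncated subtraction; it is superadditive in
   (m, k). *)
Definition charge_upos {K : realFieldType} (p N : nat) (rho : {poly {poly K}})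
    (M m : nat) (F : {poly {poly {poly K}}}) : Prop :=
  forall k r, (r <= maxn (m * (p * N).+1 - k) (m * (2 * p * N).+1 - 2 * k))%N ->
  forall i, (i < M)%N -> upos (rho ^+ r * F`_k)`_i.

(** The bound at (m1 + m2, k) is at most the sum of those at (m1, l) and (m2, k - l), so the factors
    rho can be shared: r1 of them go to F1, the others to F2. *)
Lemma charge_uposM (K : realFieldType) (p N : nat) (rho : {poly {poly K}})
    (M m1 m2 : nat) (F1 F2 : {poly {poly {poly K}}}) :
  charge_upos p N rho M m1 F1 -> charge_upos p N rho M m2 F2 ->
  charge_upos p N rho M (m1 + m2) (F1 * F2).
Proof.
move=> h1 h2 k r hr i ltiM; rewrite [(F1 * F2)`_k]coefM mulr_sumr coef_sum.
apply: upos_sum => l _.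
pose r1 := minn r (maxn (m1 * (p * N).+1 - l) (m1 * (2 * p * N).+1 - 2 * l)).
have := ltn_ord l; rewrite ltnS => ltlk.
have hr2 : (r - r1 <= maxn (m2 * (p * N).+1 - (k - l))
                       (m2 * (2 * p * N).+1 - 2 * (k - l)))%N.
  by move: hr; rewrite /r1 !mulnDl; lia.
have -> : rho ^+ r * (F1`_l * F2`_(k - l))
    = (rho ^+ r1 * F1`_l) * (rho ^+ (r - r1) * F2`_(k - l)).
  by rewrite -{1}(subnKC (geq_minl r _ : (r1 <= r)%N)) exprD; ring.
rewrite coefM; apply: upos_sum => j _; apply: uposM.
  by apply: h1; [apply: geq_minr | have := ltn_ord j; lia].
by apply: h2 => //; have := ltn_ord j; lia.
Qed.

Lemma charge_uposX (K : realFieldType) (p N : nat) (rho : {poly {poly K}})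
    (M m : nat) (F : {poly {poly {poly K}}}) :
  charge_upos p N rho M 1 F -> charge_upos p N rho M m (F ^+ m).
Proof.
move=> hF; elim: m => [|m IHm]; last by rewrite exprS -add1n; apply: charge_uposM.
move=> k r; rewrite !mul0n !sub0n leqn0 => /eqP-> i _.
rewrite expr0 mul1r coef1; case: (k == 0)%N; last by rewrite coef0; apply: upos0.
by rewrite coef1; apply: upos_nat.
Qed.

(** This reads [skel_eq] in degree k + p(2pN+1), where the error is invisible at order i <= N in w.
    The one-leaf trees contribute 1 at charge -1 and rho at charge 1. *)
Lemma coef_skel_rec (K : realFieldType) (p N : nat) (rho : {poly {poly K}})
    (k i r : nat) : (i <= N)%N ->
  (rho ^+ r * (skel p N 'X rho)`_k)`_i
  = (rho ^+ r * ((k == p * N)%:R + rho *+ (k == (p * N).+1)))`_i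
    + ('X * (rho ^+ r
             * (skel p N 'X rho ^+ (2 * p).+1)`_(k + p * (2 * p * N).+1)))`_i.
Proof.
move=> le; have [h eh] := @skel_eq {poly {poly K}} p N 'X rho.
set T := skel _ _ _ _ in eh *; set d := (p * (2 * p * N).+1)%N in eh *.
have : 'X * (T ^+ (2 * p).+1)`_(k + d)
   = T`_k - ((k == p * N)%:R + rho *+ (k == (p * N).+1)) + 'X^(N.+1) * h`_(k + d).
  rewrite -coefCM eh coefD coefMXn ltnNge leq_addl addnK coefCM coefB.
  congr (_ - _ + _); rewrite mulrDr mulr1 coefD coefXn mulrCA coefCM -exprSr coefXn.
  by rewrite mulr_natr.
move=> e; rewrite -coefD; have -> : 'X * (rho ^+ r * (T ^+ (2 * p).+1)`_(k + d))
   = rho ^+ r * ('X * (T ^+ (2 * p).+1)`_(k + d)) by ring.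
rewrite e -mulrDr; set c := _ + rho *+ _.
have -> : c + (T`_k - c + 'X^(N.+1) * h`_(k + d)) = T`_k + 'X^(N.+1) * h`_(k + d).
  by ring.
by rewrite mulrDr coefD mulrCA coefXnM ltnS le addr0.
Qed.

(* phi = G_1 - rho *)
Definition skel_phi {K : realFieldType} (p N : nat) (rho : {poly {poly K}}) :
    {poly {poly K}} :=
  (skel p N 'X rho)`_(p * N).+1 - rho.

Lemma coef_skel_phi (K : realFieldType) (p N : nat) (rho : {poly {poly K}})
    (i r : nat) : (i <= N)%N ->
  (rho ^+ r * skel_phi p N rho)`_i
  = ('X * (rho ^+ r * (skel p N 'X rho ^+ (2 * p).+1)
             `_((p * N).+1 + p * (2 * p * N).+1)))`_i.
Proof.
move=> le; rewrite mulrBr coefB coef_skel_rec // eqxx gtn_eqF //.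
by rewrite add0r mulr1n addrC addKr.
Qed.

Lemma skel_upos (K : realFieldType) (p N : nat) (rho : {poly {poly K}}) :
  (forall i, (i <= N)%N -> rho`_i = (i == 0)%:R + 'X * (skel_phi p N rho)`_i) ->
  charge_upos p N rho N.+1 1 (skel p N 'X rho).
Proof.
move=> hrho.
suff h M : (M <= N.+1)%N -> charge_upos p N rho M 1 (skel p N 'X rho) by exact: h.
elim: M => [_|M IHM ltMN] k r //; rewrite !mul1n => hr i; rewrite ltnS => leiM.
have leiN : (i <= N)%N by apply: leq_trans leiM _.
set T := skel _ _ _ _ in IHM *; set b := (2 * p).+1.
(* The root of a tree costs one factor w, so its 2p+1 subtrees only involve orders below i, covered
   by [IHM]. *)
have posT l s : (s <= maxn (b * (p * N).+1 - (l + p * (2 * p * N).+1))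
       (b * (2 * p * N).+1 - 2 * (l + p * (2 * p * N).+1)))%N ->
    upos ('X * (rho ^+ s * (T ^+ b)`_(l + p * (2 * p * N).+1)))`_i.
  move=> hs; rewrite coefXM; case: eqP => [_|ne]; first exact: upos0.
  have Mlt : (i.-1 < M)%N by lia.
  exact: (@charge_uposX _ _ _ _ _ b _ (IHM (ltnW ltMN))) hs _ Mlt.
have posG1 : upos T`_(p * N).+1`_i.
  have -> : T`_(p * N).+1 = rho + skel_phi p N rho by rewrite addrC subrK.
  rewrite coefD hrho // -addrA -{2}[(skel_phi _ _ _)`_i]mul1r -mulrDl.
  apply: uposD; first exact: upos_nat.
  apply: uposM; first exact: upos_uplus1.
  rewrite -[skel_phi _ _ _]mul1r -(expr0 rho) coef_skel_phi //.
  exact: posT.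
have [ek|nk] := eqVneq k (p * N).+1.
  have -> : r = 0%N by move: hr; rewrite ek; lia.
  by rewrite expr0 mul1r ek.
(* At charge -1 the bound on r is 1. For r = 0 the one-leaf tree contributes 1; for r = 1 the
   symmetry reduces the claim to G_1. *)
have [ek|nk'] := eqVneq k (p * N)%N.
  case: r hr => [|[|r]] hr; last by move: hr; rewrite ek; lia.
    rewrite coef_skel_rec // ek eqxx ltn_eqF // addr0 expr0 !mul1r.
    apply: uposD; first by rewrite coef1; apply: upos_nat.
    by rewrite -[_`_(_ + _)]mul1r -(expr0 rho); apply: posT.
  by rewrite expr1 ek coef_skel_sym.
(* Other charges have no one-leaf tree, and at equal charge the bound for 2p+1 trees is at least
   that for one. *)
rewrite coef_skel_rec // (negPf nk) (negPf nk') addr0 mulr0 coef0 add0r.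
apply: posT; move: hr nk nk'; rewrite /b !mulSn !mulnS.
have -> : (2 * p * (2 * p * N) = 2 * (p * (2 * p * N)))%N by lia.
have -> : (2 * p * (p * N) = p * (2 * p * N))%N by lia.
lia.
Qed.

Lemma skel_phi_upos (K : realFieldType) (p N : nat) (rho : {poly {poly K}})
    (i j : nat) :
  (forall i, (i <= N)%N -> rho`_i = (i == 0)%:R + 'X * (skel_phi p N rho)`_i) ->
  (i <= N)%N -> (j <= p)%N ->
  upos (rho ^+ j * skel_phi p N rho)`_i.
Proof.
move=> hrho leiN lejp; rewrite coef_skel_phi // coefXM.
case: eqP => [_|ne]; first exact: upos0.
(* For 2p+1 subtrees of total charge 1 the bound is ((2p+1) - 1)/2 = p, hence the condition on j. *)
apply: (@charge_uposX _ _ _ _ _ (2 * p).+1 _ (skel_upos _ _ _ _ hrho)); last by lia.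
rewrite !mulSn !mulnS.
have -> : (2 * p * (p * N) = p * (2 * p * N))%N by lia.
lia.
Qed.

(** * The numbers [rcoef] as counts of trees of charge 1 *)

Lemma rcoefE (K : realFieldType) (p n : nat) :
  rcoef K p.+1 n
  = (raney (2 * p).+1 n 1 * 'C((2 * p * n).+1, (p * n).+1))%:R.
Proof.
rewrite /rcoef (_ : p.+1 - 1 = p)%N; last by lia.
have -> : ((2 * p.+1 - 1) * n = (2 * p).+1 * n)%N by lia.
have nz (m : nat) : (m`!)%:R != 0 :> K by rewrite pnatr_eq0 -lt0n fact_gt0.
apply: (canLR (mulfK _)); first by rewrite !mulf_neq0.
rewrite -!natrM; congr (_%:R).
(* The factor (2pn+1)! of Raney's formula cancels against that of the binomial. *)
have e1 := raney_fact p n 0; rewrite addn0 mul1n addn1 in e1.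
have le : ((p * n).+1 <= (2 * p * n).+1)%N by lia.
have e2 := bin_fact le.
have e3 : ((2 * p * n).+1 - (p * n).+1 = p * n)%N by lia.
rewrite e3 in e2.
by rewrite -e1 -e2; ring.
Qed.

(** * Powers of R in terms of rho *)

Lemma fps_expS (K : realFieldType) (R : fps K) (m k : nat) :
  fps_exp R m.+1 k = \sum_(i < k.+1) R i * fps_exp R m (k - i)%N.
Proof. by []. Qed.

Lemma fps_exp1 (K : realFieldType) (R : fps K) (k : nat) : fps_exp R 1 k = R k.
Proof.
rewrite fps_expS big_ord_recr /= subnn mulr1 big1 ?add0r // => i _.
by rewrite /fps_exp /= /fps_one gtn_eqF ?mulr0 // subn_gt0.
Qed.

Lemma fps_exp_order (K : realFieldType) (R : fps K) (m k : nat) :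
  R 0%N = 0 -> (k < m)%N -> fps_exp R m k = 0.
Proof.
move=> R0; elim: m k => // m IHm k ltkm; rewrite fps_expS big1 // => i _.
have [->|i0] := eqVneq (val i) 0%N; first by rewrite R0 mul0r.
by rewrite IHm ?mulr0 //; have := ltn_ord i; move: i0 => /=; lia.
Qed.

Lemma fps_exp_shift (K : realFieldType) (R : fps K) (m k : nat) :
  R 0%N = 0 -> fps_exp R m (k + m)%N = fps_exp (fun i => R i.+1) m k.
Proof.
move=> R0; elim: m k => [|m IHm] k; first by rewrite addn0.
rewrite !fps_expS addnS big_ord_recl R0 mul0r add0r.
rewrite -addSn big_split_ord /= [X in _ + X]big1 ?addr0 => [|i _]; last first.
  rewrite fps_exp_order ?mulr0 //; have := ltn_ord i.
  by rewrite /bump /=; lia.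
apply: eq_bigr => i _; rewrite /bump add1n -IHm; congr (_ * fps_exp _ _ _).
by have := ltn_ord i; rewrite /=; lia.
Qed.

Lemma fps_exp_poly (K : realFieldType) (R : fps K) (M m k : nat) :
  (k < M)%N -> fps_exp R m k = ((\poly_(i < M) R i) ^+ m)`_k.
Proof.
elim: m k => [|m IHm] k ltkM; first by rewrite expr0 coef1.
rewrite fps_expS exprS coefM; apply: eq_bigr => i _.
have := ltn_ord i; rewrite ltnS => leik.
by rewrite coef_poly (leq_ltn_trans leik ltkM) IHm // (leq_ltn_trans (leq_subr _ _)).
Qed.

Lemma R_series_support {K : realFieldType} {p : nat} {R : fps K} (k m : nat) :
  is_R_series p.+1 R -> (0 < p)%N -> k <> m %[mod p] -> fps_exp R m k = 0.
Proof.
move=> [R0 eR] p0; move: m; elim/ltn_ind: k => k IHk.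
(* As R has no constant term, a power of exponent at least 2 at order k only involves coefficients
   of lower order, covered by [IHk]. *)
have hm m : k <> m.+2 %[mod p] -> fps_exp R m.+2 k = 0.
  move=> ne; rewrite fps_expS big1 // => i _.
  have [->|i0] := eqVneq (val i) 0%N; first by rewrite R0 mul0r.
  have [->|ik] := eqVneq (val i) k.
    by rewrite subnn [fps_exp _ _ 0]fps_exp_order ?mulr0.
  have ltik : (i < k)%N by have := ltn_ord i; rewrite ltnS leq_eqVlt (negPf ik).
  have [e|/eqP ne1] := eqVneq (i %% p)%N (1 %% p)%N; last first.
    by rewrite -fps_exp1 IHk ?mul0r.
  rewrite [X in _ * X]IHk ?mulr0 //; first by move: i0 => /=; lia.
  move=> e2; apply: ne; rewrite -(subnKC (ltnW ltik)) -modnDm e e2 modnDm.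
  by rewrite add1n.
case=> [|[|m]] ne; last exact: hm.
  by case: k ne {IHk hm} => // /(_ erefl).
rewrite fps_exp1 eR; case: eqP => [e|_]; first by case: ne; rewrite e.
rewrite add0r big_nat big1 ?mulr0 // => l /andP[l0 _].
(* For l >= 1 the exponent pl+1 is at least 2, so [hm] applies at the same order k. *)
have [m em] : exists m, (p * l = m.+1)%N.
  by exists (p * l).-1; rewrite prednK // muln_gt0 p0.
rewrite subSS subn0 em hm ?mulr0 // => e2; apply: ne; rewrite e2.
by rewrite -em -addn1 mulnC modnMDl.
Qed.

Definition rho_poly {K : realFieldType} (p N : nat) (R : fps K) :
    {poly {poly K}} :=
  \poly_(i < N.+1) R (p * i).+1.

(** By [R_series_support], R/z is a series in z^p, so its truncation is [rho_poly] composed with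
    X^p. *)
Lemma fps_exp_rho (K : realFieldType) (p N m i : nat) (R : fps K) :
  is_R_series p.+1 R -> (0 < p)%N -> (i <= N)%N ->
  fps_exp R m (p * i + m)%N = (rho_poly p N R ^+ m)`_i.
Proof.
move=> hR p0 leiN; have [R0 _] := hR; rewrite fps_exp_shift //.
rewrite (@fps_exp_poly _ _ (p * N).+1); last by rewrite ltnS leq_mul2l leiN orbT.
have -> : \poly_(k < (p * N).+1) R k.+1
    = rho_poly p N R \Po 'X^p.
  apply/polyP => k; rewrite coef_comp_poly_Xn // !coef_poly ltnS.
  have [/dvdnP[l ->]|nd] := boolP (p %| k)%N.
    by rewrite mulnK // mulnC leq_pmul2l.
  case: ifP => // _; rewrite -fps_exp1 (R_series_support _ _ hR) //.
  rewrite -addn1 -{2}(add0n 1%N) => /eqP; rewrite eqn_modDr mod0n.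
  by rewrite -/(dvdn _ _) (negPf nd).
by rewrite -rmorphXn /= coef_comp_poly_Xn // dvdn_mulr // mulKn.
Qed.

(** The term n = 0 of G_1 is rho and cancels; what remains is the sum in the equation for R, in
    terms of w and rho. *)
Lemma skel_phiE (K : realFieldType) (p N : nat) (rho : {poly {poly K}}) :
  skel_phi p N rho
  = \sum_(1 <= l < N.+1) (rcoef K p.+1 l)%:P%:P * 'X^l * rho ^+ (p * l).+1.
Proof.
rewrite /skel_phi -addn1 coef_skel -(big_mkord xpredT (fun n =>
  (raney (2 * p).+1 n 1 * 'C((2 * p * n).+1, p * n + 1))%:R * 'X^n
    * rho ^+ (p * n + 1))).
rewrite big_ltn // raney0 muln0 muln0 bin1 !mul1r expr1 addrC addKr.
by apply: eq_bigr => l _; rewrite addn1 rcoefE !polyC_natr.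
Qed.

Lemma sum_nat_trunc {V : nmodType} {m i : nat} {F : nat -> V} :
  (i <= m)%N -> (forall l, (i < l)%N -> F l = 0) ->
  \sum_(1 <= l < m.+1) F l = \sum_(1 <= l < i.+1) F l.
Proof.
move=> leim F0; rewrite (@big_cat_nat _ _ _ i.+1) //= [X in _ + X]big_nat.
by rewrite [X in _ + X]big1 ?addr0 // => l /andP[/F0].
Qed.

(** This is the equation for R at z^(pi+1), where R^(pl+1) contributes the coefficient of w^(i-l) in
    rho^(pl+1). Both sums are cut to l <= i, their later terms being zero. *)
Lemma rho_poly_eq (K : realFieldType) (p N i : nat) (R : fps K) :
  is_R_series p.+1 R -> (0 < p)%N -> (i <= N)%N ->
  (rho_poly p N R)`_i
  = (i == 0)%:R + 'X * (skel_phi p N (rho_poly p N R))`_i.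
Proof.
move=> hR p0 leiN; have [R0 eR] := hR.
have pi0 : (p * i == 0)%N = (i == 0)%N by rewrite muln_eq0 eqn0Ngt p0.
rewrite {1}/rho_poly coef_poly ltnS leiN eR eqSS pi0.
congr (_ + 'X * _).
rewrite skel_phiE coef_sum.
have lei : (i <= (p * i).+1)%N by rewrite ltnW // ltnS leq_pmull.
rewrite (sum_nat_trunc lei) => [|l lt]; last first.
  by rewrite subSS subn0 fps_exp_order ?mulr0 // ltnS ltn_pmul2l.
rewrite [RHS](sum_nat_trunc leiN) => [|l lt]; last first.
  by rewrite -mulrA coefCM coefXnM lt mulr0.
apply: eq_big_nat => l /andP[_ le]; rewrite ltnS in le.
rewrite subSS subn0 -mulrA coefCM coefXnM (leq_gtF le); congr (_ * _).
rewrite -fps_exp_rho //; last exact: leq_trans (leq_subr _ _) leiN.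
by congr (fps_exp _ _ _); rewrite addnS -mulnDr subnK.
Qed.

Theorem theorem5p3p1 (K : realFieldType) (q : nat) (R : fps K) :
  (2 <= q)%N ->
  is_R_series q R ->
  forall n : nat, (1 <= n <= q)%N ->
    exists S : fps K,
      (forall k : nat, 'X * S k = fps_exp R n k - fps_zpow K n k) /\
      uplus1_positive S.
Proof.
case: q => // p p0 hR n /andP[n0 nq]; rewrite ltnS in p0.
pose rho N := rho_poly p N R.
have hrho N i : (i <= N)%N ->
    (rho N)`_i = (i == 0)%:R + 'X * (skel_phi p N (rho N))`_i.
  exact: rho_poly_eq.
(* Up to order N in w this is (rho^n - 1)/u, by the geometric sum and rho - 1 = u * phi. *)
pose W N := \sum_(j < n) rho N ^+ j * skel_phi p N (rho N).
(* The coefficient at z^(n+pi) is that of w^i in W; truncation at order k = n + pi suffices since i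
   <= k. *)
exists (fun k => if (n <= k)%N && (p %| k - n)%N
                 then (W k)`_((k - n) %/ p) else 0).
split=> k.
  case: ifP => [/andP[lenk /dvdnP[i ei]]|nk]; last first.
    rewrite mulr0 /fps_zpow; case: eqP nk => [-> |_ nk].
      by rewrite leqnn subnn dvdn0.
    rewrite subr0; have [ltkn|lenk] := ltnP k n.
      by rewrite fps_exp_order //; case: hR.
    rewrite (R_series_support _ _ hR) // => e.
    by move: nk; rewrite lenk /= -eqn_mod_dvd // e eqxx.
  rewrite ei mulnK //; have -> : (k = p * i + n)%N by lia.
  set N := (p * i + n)%N.
  have leiN : (i <= N)%N by rewrite (leq_trans (leq_pmull i p0)) // leq_addr.
  rewrite (@fps_exp_rho _ p N) //.
  have -> : fps_zpow K n N = (1 : {poly {poly K}})`_i.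
    by rewrite /fps_zpow coef1 /N -{2}(add0n n) eqn_add2r muln_eq0 eqn0Ngt p0.
  rewrite -coefB subrX1 /W -mulr_suml -/(rho N).
  rewrite [_ * skel_phi _ _ _]mulrC !coefM mulr_sumr; apply: eq_bigr => l _.
  rewrite (coefB (rho N) 1) hrho; last by have := ltn_ord l; lia.
  by rewrite coef1 addrC addKr mulrA.
move=> j; case: ifP => [/andP[lenk _]|_]; last by rewrite comp_poly0 coef0.
move: j; rewrite -/(upos _) /W coef_sum; apply: upos_sum => l _.
apply: skel_phi_upos; first exact: hrho.
  by apply: leq_trans (leq_div _ _) (leq_subr _ _).
by rewrite -ltnS (leq_trans (ltn_ord l)).
Qed.
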